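(* Let $K$ be a field of characteristic zero, let $E$ be a finite set, and let $W\subseteq K^E$ be a nonzero configuration of dimension $m$. Then, as subsets of $\mathbb{P}(K^E)$, $$\operatorname{Sing}_{\geq k} X_W = D_{m-k-1}(B_E|_W)\qquad\text{for all } 1\leq k\leq m-1 .$$ In particular, for $1\le k\le m$, $$\operatorname{Mult}_k X_W = \operatorname{Corank}_k B_E|_W ,$$ where $\operatorname{Corank}_k B_E|_W$ is the set of points $a\in\mathbb{P}(K^E)$ such that the bilinear form $B_E(a)|_W$ has corank exactly $k$ on $W$.
   Context: $K^E$ is the $K$-vector space with basis $E=\{e_1,\dots,e_n\}$; $X_e:K^E\to K$ denotes the coordinate function of $e\in E$. For $a=\sum_e a_e e\in K^E$, $B_E(a)$ is the symmetric bilinear form $B_E(a)(v,w)=\sum_{e\in E}a_eX_e(v)X_e(w)$. A configuration is a linear subspace $W\subseteq K^E$; $B_E(a)|_W$ is the restriction of $B_E(a)$ to $W$ (its rank depends only on the class of $a$ in $\mathbb{P}(K^E)$ when $a\ne0$). The corank of a form on $W$ is $\dim W$ minus its rank. With variables $A_e$ ($e\in E$), the configuration polynomial $\Psi_W(A)\in K[A_e: e\in E]$ of a nonzero configuration $W$ with basis $w_1,\dots,w_m$ is $\det\big(\sum_{e}A_eX_e(w_i)X_e(w_j)\big)_{i,j}$; it is well defined up to a nonzero scalar and homogeneous of degree $m=\dim W$. The configuration hypersurface is $X_W=\{a\in\mathbb{P}(K^E): \Psi_W(a)=0\}$, with homogeneous ideal $\langle\Psi_W\rangle$. Degeneracy loci: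 $D_r(B_E|_W)=\{a\in\mathbb{P}(K^E): \operatorname{rank}(B_E(a)|_W)\leq r\}$. For a homogeneous ideal $I\subseteq K[A_1,\dots,A_n]$, $S(I)$ is the ideal generated by $\{\partial f/\partial A_i: f\in I,\ 1\le i\le n\}$, and $S^{(k)}(I)=S(S^{(k-1)}(I))$, $S^{(0)}(I)=I$. For $X$ the projective variety defined by $I$, $\operatorname{Sing}_{\ge k}X$ is the locus in $\mathbb{P}(K^E)$ defined by $S^{(k)}(I)$ (here regarded as a set of points); $\operatorname{Sing}_{\ge0}X=X$. $\operatorname{Mult}_kX=\operatorname{Sing}_{\geq k-1}X\setminus\operatorname{Sing}_{\geq k}X$. *)

(* Defs.v *)
From HB Require Import structures.
From mathcomp Require Import all_boot all_order all_algebra ring.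
From mathcomp.multinomials Require Export mpoly.

Set Implicit Arguments.
Unset Strict Implicit.
Unset Printing Implicit Defensive.

Import GRing.Theory.
Local Open Scope ring_scope.

Section Forms.

Variables (K : fieldType) (n : nat).

(* K^E for E = {e_1, ..., e_n} is 'rV[K]_n, and X_e v is v 0 e. *)
Definition BE (a v w : 'rV[K]_n) : K := \sum_(e < n) a 0 e * v 0 e * w 0 e.

Lemma BE_bilinear a : bilinear_for *%R *%R (BE a).
Proof.
by split=> u c v w /=; rewrite /BE mulr_sumr -big_split; apply: eq_bigr => e _;
  rewrite /= !mxE; ring.
Qed.

HB.instance Definition _ a :=
  bilinear_isBilinear.Build K 'rV[K]_n 'rV[K]_n K *%R *%R (BE a) (BE_bilinear a).

End Forms.

Section RestrictRank.

Variables (K : fieldType) (V : vectType K).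

Definition form_restr (W : {vspace V}) (b : {biscalar V}) (u v : subvs_of W) : K :=
  b (vsval u) (vsval v).

Arguments form_restr W b u v : clear implicits.

Lemma form_restr_bilinear W b : bilinear_for *%R *%R (form_restr W b).
Proof.
split=> u c v w /=; rewrite /form_restr.
- by rewrite linearP linearPl.
- by rewrite !linearP.
Qed.

HB.instance Definition _ W b :=
  bilinear_isBilinear.Build K (subvs_of W) (subvs_of W) K *%R *%R
    (form_restr W b) (@form_restr_bilinear W b).

(* The rank of the Gram matrix; it does not depend on the basis. *)
Definition form_rank (b : {biscalar V}) : nat :=
  let B := vbasis {:V} in \rank (\matrix_(i, j) b (tnth B i) (tnth B j)).

Definition form_corank (b : {biscalar V}) : nat := (\dim {:V} - form_rank b)%N.

End RestrictRank.

Arguments form_restr {K V} W b u v.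

Section Projective.

Variables (K : fieldType) (n : nat).

Definition proj_space := {L : {vspace 'rV[K]_n} | \dim L == 1%N}.

(* The set of points all of whose homogeneous coordinate vectors satisfy P.
   Below it is used with P invariant under nonzero scaling, so that one
   representative of each point is as good as all of them. *)
Definition proj_set (P : 'rV[K]_n -> Prop) (p : proj_space) : Prop :=
  forall a, a \in val p -> a != 0 -> P a.

End Projective.

Section Ideals.

Variables (K : fieldType) (n : nat).

(* Ideals are Prop-valued predicates: mathcomp's idealr only covers decidable
   proper ideals, whereas the iterated S ideals below may be improper. *)
Definition gen_ideal (G : {mpoly K[n]} -> Prop) (f : {mpoly K[n]}) : Prop :=
  exists s : seq ({mpoly K[n]} * {mpoly K[n]}),
    (forall cg, cg \in s -> G cg.2) /\ f = \sum_(cg <- s) cg.1 * cg.2.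

Definition S_ideal (I : {mpoly K[n]} -> Prop) : {mpoly K[n]} -> Prop :=
  gen_ideal (fun g => exists f (i : 'I_n), I f /\ g = mderiv i f).

Definition zero_locus (I : {mpoly K[n]} -> Prop) : proj_space K n -> Prop :=
  proj_set (fun a => forall f, I f -> f.@[fun i => a 0 i] = 0).

(* Sing_{>= k} and Mult_k of the projective variety with ideal I. *)
Definition Sing_ge (k : nat) (I : {mpoly K[n]} -> Prop) : proj_space K n -> Prop :=
  zero_locus (iter k S_ideal I).

Definition Mult (k : nat) (I : {mpoly K[n]} -> Prop) (p : proj_space K n) : Prop :=
  Sing_ge (k - 1) I p /\ ~ Sing_ge k I p.

End Ideals.

Section Configurations.

Variables (K : fieldType) (n : nat).

Definition conf_poly m (w : m.-tuple 'rV[K]_n) : {mpoly K[n]} :=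
  \det (\matrix_(i < m, j < m)
          \sum_(e < n) (tnth w i 0 e * tnth w j 0 e) *: 'X_e).

Definition conf_ideal m (w : m.-tuple 'rV[K]_n) : {mpoly K[n]} -> Prop :=
  gen_ideal (fun g => g = conf_poly w).

Definition degeneracy_locus (W : {vspace 'rV[K]_n}) (r : nat) :
    proj_space K n -> Prop :=
  proj_set (fun a => (form_rank (form_restr W (BE a)) <= r)%N).

Definition Corank (W : {vspace 'rV[K]_n}) (k : nat) : proj_space K n -> Prop :=
  proj_set (fun a => form_corank (form_restr W (BE a)) = k).

End Configurations.

(* Main.v *)
(* By the Leibniz rule, a is in Sing_{>=k} iff all partial derivatives of order
   at most k of Psi_W vanish at a, so the claim is that Psi_W vanishes at a to
   order exactly the corank c of B(a)|_W.  Choose a basis of W whose last c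
   vectors span the radical of B(a)|_W.  The last c rows of the Gram matrix then
   vanish at a, so its determinant has order at least c.  Conversely, on a line
   a + t x the determinant is t^c h(t), where h(0) is the product of the Gram
   determinants of B(a) on a complement of the radical and of B(x) on the
   radical; the latter is nonzero when x is the indicator vector of a set of
   c independent coordinates on the radical. *)
From HB Require Import structures.
Require Import Defs.
From mathcomp Require Import all_boot all_order perm all_algebra.
From mathcomp Require Import zify ring.

Set Implicit Arguments.
Unset Strict Implicit.
Unset Printing Implicit Defensive.

Import GRing.Theory.
Local Open Scope ring_scope.

Lemma mderiv_var (R : nzRingType) (n : nat) (i j : 'I_n) :
  mderiv i ('X_j : {mpoly R[n]}) = (i == j)%:R.
Proof.
rewrite mderivX mnm1E eq_sym; case: eqP => [->|_]; last exact: scale0r.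
have -> : (U_(j) - U_(j) = 0 :> 'X_{1.. n})%MM.
  by apply/mnmP => k; rewrite mnmBE subnn mnm0E.
by rewrite mpolyX0 scale1r.
Qed.

(** * Order of vanishing at a point and iterated ideals of derivatives *)

Section OrderOfVanishing.

Variables (K : fieldType) (n : nat) (a : 'I_n -> K).

Implicit Types (f g : {mpoly K[n]}) (I : {mpoly K[n]} -> Prop).

(* All partial derivatives of [f] of order less than [k] vanish at [a]; only in
   characteristic zero is this membership in the [k]-th power of the maximal ideal. *)
Fixpoint order_ge (k : nat) (f : {mpoly K[n]}) : Prop :=
  if k is k'.+1 then f.@[a] = 0 /\ forall i, order_ge k' (mderiv i f) else True.

Lemma order_geW k f : order_ge k.+1 f -> order_ge k f.
Proof.
elim: k f => // k IH f [fa0 df]; split=> // i.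
by apply: IH; apply: df.
Qed.

Lemma order_ge_leq j k f : (j <= k)%N -> order_ge k f -> order_ge j f.
Proof.
move=> /subnK <-; by elim: (k - j)%N => // d IH /order_geW /IH.
Qed.

Lemma order_geD k f g : order_ge k f -> order_ge k g -> order_ge k (f + g).
Proof.
elim: k f g => // k IH f g [fa0 df] [ga0 dg]; split=> [|i].
  by rewrite rmorphD /= fa0 ga0 addr0.
by rewrite mderivD; apply: IH; [exact: df | exact: dg].
Qed.

Lemma order_ge0 k : order_ge k 0.
Proof.
by elim: k => // k IH; split=> [|i]; rewrite ?rmorph0 // mderiv0.
Qed.

Lemma order_ge_sum (T : Type) (s : seq T) (P : pred T) (F : T -> {mpoly K[n]}) k :
  (forall x, P x -> order_ge k (F x)) -> order_ge k (\sum_(x <- s | P x) F x).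
Proof.
move=> kF; apply: (big_ind (order_ge k)) => //.
- exact: order_ge0.
- exact: order_geD.
Qed.

(** By the Leibniz rule each derivative of [f * g] is a sum of two products whose total order drops
    by at most one; hence the induction on [j + k]. *)
Lemma order_geM j k f g :
  order_ge j f -> order_ge k g -> order_ge (j + k) (f * g).
Proof.
have [N leN] := ubnP (j + k)%N; elim: N j k f g leN => // N IH j k f g leN jf kg.
case: j k leN jf kg => [|j] [|k] leN jf kg //.
- have [ga0 dg] := kg; split=> [|i]; first by rewrite rmorphM /= ga0 mulr0.
  rewrite mderivM; apply: order_geD; apply: (IH 0%N k) => //.
    exact: order_geW.
  exact: dg.
- rewrite addn0; have [fa0 df] := jf.
  split=> [|i]; first by rewrite rmorphM /= fa0 mul0r.
  rewrite mderivM -[j]addn0; apply: order_geD; apply: IH => //;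
    first [exact: order_geW | exact: df | lia].
have [fa0 df] := jf; have [ga0 dg] := kg.
split=> [|i]; first by rewrite rmorphM /= fa0 mul0r.
rewrite mderivM; apply: order_geD.
  by apply: IH => //; exact: df.
by rewrite -[X in order_ge X](addSnnS j k); apply: IH => //; [lia | exact: dg].
Qed.

Lemma order_geMl k f g : order_ge k g -> order_ge k (f * g).
Proof. by move=> kg; apply: (@order_geM 0). Qed.

Lemma order_ge_prod (T : finType) (e : T -> nat) (F : T -> {mpoly K[n]}) :
  (forall x, order_ge (e x) (F x)) -> order_ge (\sum_x e x) (\prod_x F x).
Proof.
move=> eF; elim/big_rec2: _ => // x k f _ kf; exact: order_geM.
Qed.

Lemma gen_ideal_gen (G : {mpoly K[n]} -> Prop) g : G g -> gen_ideal G g.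
Proof.
move=> Gg; exists [:: (1, g)]; split=> [cg|]; last by rewrite big_seq1 mul1r.
by rewrite inE => /eqP ->.
Qed.

Lemma gen_idealMl (G : {mpoly K[n]} -> Prop) f g :
  gen_ideal G g -> gen_ideal G (f * g).
Proof.
case=> s [Gs ->]; exists [seq (f * cg.1, cg.2) | cg <- s]; split.
  by move=> cg /mapP[cg' /Gs Gcg' ->].
by rewrite big_map mulr_sumr; apply: eq_bigr => cg _; rewrite mulrA.
Qed.

Lemma order_ge_gen_ideal (G : {mpoly K[n]} -> Prop) k :
  (forall g, G g -> order_ge k g) -> forall f, gen_ideal G f -> order_ge k f.
Proof.
move=> kG f [s [Gs ->]]; rewrite big_seq; apply: order_ge_sum => cg cgs.
by apply/order_geMl/kG/Gs.
Qed.

(** The innermost [S_ideal] is peeled off, so the induction on [k] lets [I] vary. The index [j]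
    witnesses that a variable exists; with none, [S_ideal I] would be zero and forget [I]. *)
Lemma S_ideal_vanishing k I (j : 'I_n) : (forall f g, I g -> I (f * g)) ->
  (forall f, iter k (@S_ideal K n) I f -> f.@[a] = 0) <->
  (forall f, I f -> order_ge k.+1 f).
Proof.
elim: k I => [|k IH] I idI.
  by split=> [I0 f If|I0 f /I0[]//]; split=> //; apply: I0.
rewrite iterSr; apply: (iff_trans (IH _ _)).
  exact: gen_idealMl.
split=> [kS f If|kI].
  have dS i h : I h -> order_ge k.+1 (mderiv i h).
    by move=> Ih; apply/kS/gen_ideal_gen; exists h, i.
  split=> [|i]; last exact: dS.
  (* [f] itself vanishes at [a]: [f = d_j (X_j f) - X_j d_j f], both terms from [S(I)]. *)
  have [+ _] := dS j _ (idI 'X_j f If); have [+ _] := dS j _ If.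
  rewrite mderivM rmorphD !rmorphM /= => ->; rewrite mulr0 addr0.
  by rewrite mderiv_var eqxx rmorph1 mul1r.
move=> f; apply: order_ge_gen_ideal => _ [h [i [Ih ->]]].
by have [_] := kI h Ih; apply.
Qed.

End OrderOfVanishing.

(** * Restriction of polynomials to a line *)

Section RestrictionToLine.

Variables (K : fieldType) (n : nat) (a x : 'rV[K]_n).

Definition line_pt : 'rV[{poly K}]_n := map_mx polyC a + 'X *: map_mx polyC x.

Definition on_line : {mpoly K[n]} -> {poly K} := mmap polyC (fun i => line_pt 0 i).

HB.instance Definition _ := GRing.RMorphism.copy on_line on_line.

Lemma on_lineC c : on_line c%:MP = c%:P.
Proof. exact: mmapC. Qed.

Lemma on_lineX i : on_line 'X_i = line_pt 0 i.
Proof. by rewrite /on_line mmapX mmap1U. Qed.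

Lemma horner0_on_line f : (on_line f).[0] = f.@[fun i => a 0 i].
Proof.
rewrite /on_line /mmap /meval /mmap horner_sum; apply: eq_bigr => m _.
rewrite hornerCM /mmap1 horner_prod; congr (_ * _); apply: eq_bigr => i _.
by rewrite horner_exp !mxE !hornerE.
Qed.

Lemma deriv_on_line f :
  (on_line f)^`() = \sum_i (x 0 i)%:P * on_line (mderiv i f).
Proof.
(* [D h] is the chain rule for [h]: it holds for constants and variables and is stable under sums
   and products. *)
pose D h := (on_line h)^`() = \sum_i (x 0 i)%:P * on_line (mderiv i h).
have DC c : D c%:MP.
  rewrite /D on_lineC derivC big1 // => i _.
  by rewrite mderivC raddf0 mulr0.
have DX i : D 'X_i.
  rewrite /D on_lineX (bigD1 i) //= big1 => [|j ji].
    rewrite mderiv_var eqxx rmorph1 addr0 mulr1.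
    by rewrite !mxE derivD derivC derivM derivX derivC; ring.
  by rewrite mderiv_var (negbTE ji) raddf0 mulr0.
have DM g h : D g -> D h -> D (g * h).
  rewrite /D rmorphM derivM => -> ->; rewrite mulr_suml mulr_sumr -big_split.
  apply: eq_bigr => i _ /=; rewrite mderivM rmorphD !rmorphM /=; ring.
have DD g h : D g -> D h -> D (g + h).
  rewrite /D rmorphD derivD => -> ->; rewrite -big_split.
  by apply: eq_bigr => i _ /=; rewrite mderivD rmorphD mulrDr.
have D1 : D 1 by rewrite -mpolyC1.
rewrite -/(D f) (mpolyE f); apply: (big_ind D) => // [|m _].
  by rewrite -mpolyC0.
rewrite -mul_mpolyC mpolyXE_id; apply: (DM _ _ (DC _)).
apply: (big_ind D) => // i _.
by elim: (m i) => [|k IH]; rewrite ?expr0 // exprS; apply: DM.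
Qed.

Lemma order_ge_on_line k f : [pchar K] =i pred0 ->
  order_ge (fun i => a 0 i) k f -> forall i, (i < k)%N -> (on_line f)`_i = 0.
Proof.
move=> charK; elim: k f => // k IH f [fa0 df] [|i] ik.
  by rewrite -horner_coef0 horner0_on_line.
have /eqP: (on_line f)^`()`_i = 0.
  rewrite deriv_on_line coef_sum big1 // => j _.
  by rewrite coefCM (IH _ (df j)) ?mulr0.
(* Differentiation multiplies the coefficient of index [i + 1] by [i + 1], which is nonzero in
   characteristic zero. *)
by rewrite coef_deriv -mulr_natr mulf_eq0 ((pcharf0P _).1 charK) orbF => /eqP.
Qed.

End RestrictionToLine.

(** * Gram matrices of diagonal forms *)

Section GramMatrix.

Variable n : nat.

(** The Gram matrix of the diagonal form [d] on the rows of [u], over any ring so as to cover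
    coefficients in [{mpoly K[n]}] and [{poly K}] too. *)
Definition gram (R : comNzRingType) m (u : 'M[R]_(m, n)) (d : 'rV_n) : 'M[R]_m :=
  u *m diag_mx d *m u^T.

Lemma gram_entry (R : comNzRingType) m (u : 'M[R]_(m, n)) d i j :
  gram u d i j = \sum_e d 0 e * u i e * u j e.
Proof.
rewrite /gram mxE; apply: eq_bigr => e _; rewrite mul_mx_diag !mxE; ring.
Qed.

Lemma map_gram (R S : comNzRingType) (f : {rmorphism R -> S}) m
    (u : 'M[R]_(m, n)) d :
  map_mx f (gram u d) = gram (map_mx f u) (map_mx f d).
Proof. by rewrite /gram !map_mxM map_diag_mx map_trmx. Qed.

Lemma gram_mulmx (R : comNzRingType) k m (P : 'M[R]_(k, m)) (u : 'M[R]_(m, n)) d :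
  gram (P *m u) d = P *m gram u d *m P^T.
Proof. by rewrite /gram trmx_mul !mulmxA. Qed.

Lemma tr_gram (R : comNzRingType) m (u : 'M[R]_(m, n)) d : (gram u d)^T = gram u d.
Proof. by rewrite /gram !trmx_mul trmxK tr_diag_mx mulmxA. Qed.

Lemma gram_indicator (R : comNzRingType) m c (f : 'I_c -> 'I_n) (u : 'M[R]_(m, n)) :
  injective f ->
  gram u (\row_e (e \in codom f)%:R) = colsub f u *m (colsub f u)^T.
Proof.
move=> injf; apply/matrixP => i j; rewrite gram_entry mxE.
rewrite (bigID (fun e => e \in codom f)) /= [X in _ + X]big1 ?addr0 => [|e nf].
  rewrite (reindex_omap f (fun e => [pick k | f k == e])) /= => [|e /codomP[k ->]].
    apply: eq_big => [k|k _]; last by rewrite !mxE codom_f mul1r.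
    rewrite codom_f; case: pickP => [l /eqP/injf ->|/(_ k)]; last by rewrite eqxx.
    exact: eqxx.
  by case: pickP => /= [l /eqP ->|/(_ k)]; rewrite ?eqxx.
by rewrite mxE (negbTE nf) !mul0r.
Qed.

(** Full row rank provides [c] columns forming an invertible matrix [M]; the indicator vector of
    these columns gives the Gram matrix [M *m M^T]. *)
Lemma gram_unit_exists (F : fieldType) c (u : 'M[F]_(c, n)) :
  row_free u -> exists x, gram u x \in unitmx.
Proof.
move=> freeu; have fullu : row_full u^T by rewrite /row_full mxrank_tr.
exists (\row_e (e \in codom (fullrankfun fullu))%:R).
rewrite gram_indicator; last exact: fullrankfun_inj.
rewrite unitmx_mul unitmx_tr andbb -unitmx_tr.
suff -> : (colsub (fullrankfun fullu) u)^T = rowsub (fullrankfun fullu) u^T.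
  exact: fullrowsub_unit.
by apply/matrixP => i j; rewrite !mxE.
Qed.

(** In the factorization [G = C *m pid_mx r *m R] with [C] invertible, multiplying by the inverse of
    [C] on the left kills the rows of index at least [r], and the factor [P^T] on the right keeps
    them zero. *)
Lemma gram_adapted_basis (F : fieldType) m (u : 'M[F]_(m, n)) a :
  exists2 P : 'M_m, P \in unitmx &
    forall i j : 'I_m, (\rank (gram u a) <= i)%N -> gram (P *m u) a i j = 0.
Proof.
set G := gram u a; exists (invmx (col_ebase G)).
  by rewrite unitmx_inv col_ebase_unit.
move=> i j ri; rewrite gram_mulmx -/G -[X in _ *m X *m _]mulmx_ebase.
rewrite -!mulmxA mulKmx ?col_ebase_unit // mxE big1 // => k _.
by rewrite mxE ltnNge ri andbF mul0r.
Qed.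

End GramMatrix.

(** * The generic Gram determinant and its order at a point *)

Section GenericGram.

Variables (K : fieldType) (n : nat).

Definition gen_det m (u : 'M[K]_(m, n)) : {mpoly K[n]} :=
  \det (gram (map_mx (@mpolyC n K) u) (\row_e 'X_e)).

Lemma gen_det_mulmx m (P : 'M[K]_m) (u : 'M[K]_(m, n)) :
  gen_det (P *m u) = (\det P ^+ 2)%:MP * gen_det u.
Proof.
rewrite /gen_det map_mxM gram_mulmx !det_mulmx det_tr det_map_mx.
by rewrite rmorphXn expr2 /=; ring.
Qed.

Lemma order_ge_gen_det m (u : 'M[K]_(m, n)) (a : 'rV_n) :
  order_ge (fun i => a 0 i) (m - \rank (gram u a)) (gen_det u).
Proof.
have [P unitP rowP] := gram_adapted_basis u a.
have detP : \det P ^+ 2 != 0 by rewrite expf_neq0 // -unitfE -unitmxE.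
have -> : gen_det u = (\det P ^- 2)%:MP * gen_det (P *m u).
  by rewrite gen_det_mulmx mulrA -mpolyCM mulVf // mul1r.
apply: order_geMl; move: (P *m u) rowP => v rowv; set r := \rank _ in rowv *.
rewrite /gen_det /determinant; apply: order_ge_sum => s _.
apply: order_geMl.
(* Entries of row [i] are given order 1 if [r <= i] and 0 otherwise; along a permutation these add
   up to [m - r]. *)
have -> : (m - r = \sum_(i < m) (r <= i))%N.
  have sumE k : (\sum_(i < k) (r <= i) = k - r)%N.
    by elim: k => [|k IH]; rewrite ?big_ord0 // big_ord_recr /= IH; lia.
  by rewrite sumE.
apply: order_ge_prod => i; case: leqP => //= ri; split=> //.
rewrite -(rowv i (s i) ri) !gram_entry rmorph_sum; apply: eq_bigr => e _.
by rewrite !rmorphM /= !mxE mevalXU !mevalC.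
Qed.

Lemma gen_det_order_le m (u : 'M[K]_(m, n)) (a : 'rV_n) :
  [pchar K] =i pred0 -> row_free u ->
  ~ order_ge (fun i => a 0 i) (m - \rank (gram u a)).+1 (gen_det u).
Proof.
move=> charK freeu.
have [P unitP rowP] := gram_adapted_basis u a.
move=> /(order_geMl (\det P ^+ 2)%:MP); rewrite -gen_det_mulmx.
have {freeu} : row_free (P *m u).
  by rewrite /row_free mxrankMfree // mxrank_unit.
have: \rank (gram u a) = \rank (gram (P *m u) a).
  have fullP : row_full P by rewrite row_full_unit.
  rewrite gram_mulmx; move: (gram u a) => G.
  by rewrite mxrankMfree ?row_free_unit ?unitmx_tr // (eqmxMfull _ fullP).
move: (P *m u) rowP => v rowv rankE freev.
have [c mE] : exists c, m = (\rank (gram u a) + c)%N.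
  by exists (m - \rank (gram u a))%N; rewrite subnKC // rank_leq_row.
move: (\rank (gram u a)) mE rowv rankE => r mE.
move: m mE u P unitP v freev => _ -> _ _ _ v freev rowv rankE; rewrite addKn => ordc.
have [G defG] : exists G, G = gram v a by exists (gram v a).
have trG : G^T = G by rewrite defG tr_gram.
rewrite -defG in rowv rankE.
(* The last [c] rows of [v] span the radical and are independent as part of a free family. *)
have [x unitD] : exists x, gram (dsubmx v) x \in unitmx.
  apply: gram_unit_exists; move: freev; rewrite -kermx_eq0 => /eqP kerv.
  apply/inj_row_free => y yN; have: row_mx 0 y *m v = 0.
    by rewrite -[v]vsubmxK mul_row_col mul0mx add0r.
  by move/sub_kermxP; rewrite kerv submx0 => /eqP; rewrite -row_mx0 => /eq_row_mx[].
set Q := ulsubmx G.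
(* Symmetry turns the vanishing last rows into vanishing last columns. *)
have GE : G = block_mx Q 0 0 0.
  rewrite -[LHS]submxK -/Q; congr block_mx; apply/matrixP => i j; rewrite !mxE.
  - by rewrite -trG mxE rowv ?leq_addr.
  - by rewrite rowv ?leq_addr.
  - by rewrite rowv ?leq_addr.
have unitQ : Q \in unitmx.
  rewrite -row_free_unit /row_free; apply/eqP.
  by rewrite [RHS]rankE GE rank_diag_block_mx mxrank0 addn0.
have [S defS] : exists S, S = gram v x by exists (gram v x).
have DE : drsubmx S = gram (dsubmx v) x.
  by apply/matrixP => i j; rewrite gram_entry !mxE defS gram_entry;
    apply: eq_bigr => e _; rewrite !mxE.
(* The last [c] rows of [G + 'X *: S] are divisible by ['X]; [H] is obtained by dividing them by
   ['X]. *)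
pose H : 'M[{poly K}]_(r + c) :=
  block_mx (map_mx polyC Q + 'X *: map_mx polyC (ulsubmx S))
    ('X *: map_mx polyC (ursubmx S))
    (map_mx polyC (dlsubmx S)) (map_mx polyC (drsubmx S)).
have lineE : on_line a x (gen_det v) = 'X^c * \det H.
  transitivity (\det (map_mx polyC G + 'X *: map_mx polyC S)).
    rewrite -det_map_mx map_gram; congr (\det _); apply/matrixP => i j.
    rewrite gram_entry mxE [X in _ + X]mxE defG defS !map_gram !gram_entry mulr_sumr -big_split.
    apply: eq_bigr => e _ /=; rewrite !mxE on_lineX !on_lineC !mxE; ring.
  have -> : map_mx polyC G + 'X *: map_mx polyC S = block_mx 1%:M 0 0 ('X)%:M *m H.
    rewrite /H mulmx_block !mul1mx !mul0mx !add0r !addr0 !mul_scalar_mx.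
    rewrite -[S in LHS]submxK GE !map_block_mx scale_block_mx add_block_mx.
    by rewrite !map_mx0 !add0r.
  by rewrite det_mulmx det_ublock det1 mul1r det_scalar.
(* Order at least [c + 1] kills the coefficient of ['X^c], which is [\det H] at 0; there [H] is
   block lower triangular with invertible diagonal blocks [Q] and [drsubmx S]. *)
have := order_ge_on_line x charK ordc (ltnSn c).
rewrite lineE coefXnM ltnn subnn -horner_coef0 => /eqP.
rewrite -/(horner_eval 0 _) -det_map_mx map_block_mx.
have -> : map_mx (horner_eval 0) (map_mx polyC Q + 'X *: map_mx polyC (ulsubmx S)) = Q.
  by apply/matrixP => i j; rewrite !mxE /horner_eval !hornerE.
have -> : map_mx (horner_eval 0) ('X *: map_mx polyC (ursubmx S)) = 0.
  by apply/matrixP => i j; rewrite !mxE /horner_eval !hornerE.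
have -> : map_mx (horner_eval 0) (map_mx polyC (drsubmx S)) = drsubmx S.
  by apply/matrixP => i j; rewrite !mxE /horner_eval !hornerE.
rewrite det_lblock DE mulf_eq0 => /orP[] /eqP det0.
  by move: unitQ; rewrite unitmxE det0 unitr0.
by move: unitD; rewrite unitmxE det0 unitr0.
Qed.

End GenericGram.

(** * The rank of the restricted form in coordinates *)

Section FormRank.

Variables (K : fieldType) (n : nat).

Definition rows_mx k (s : k.-tuple 'rV[K]_n) : 'M_(k, n) := \matrix_i tnth s i.

Lemma conf_polyE m (w : m.-tuple 'rV[K]_n) : conf_poly w = gen_det (rows_mx w).
Proof.
congr (\det _); apply/matrixP => i j; rewrite gram_entry mxE.
by apply: eq_bigr => e _; rewrite !mxE -mul_mpolyC rmorphM /=; ring.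
Qed.

Lemma row_free_rows_mx k (s : k.-tuple 'rV[K]_n) : free s -> row_free (rows_mx s).
Proof.
move=> /freeP frees; apply/inj_row_free => y.
rewrite mulmx_sum_row => ys0; apply/rowP => i; rewrite mxE.
apply: (frees (fun i => y 0 i)); rewrite -[RHS]ys0; apply: eq_bigr => j _.
by rewrite rowK (tnth_nth 0).
Qed.

Lemma mxrank_gram_leq k l (u : 'M[K]_(k, n)) (v : 'M[K]_(l, n)) a :
  (u <= v)%MS -> (\rank (gram u a) <= \rank (gram v a))%N.
Proof.
case/submxP => D ->; rewrite gram_mulmx.
exact: leq_trans (mxrankM_maxl _ _) (mxrankM_maxr _ _).
Qed.

Lemma mxrank_gramZ k (u : 'M[K]_(k, n)) c a :
  c != 0 -> \rank (gram u (c *: a)) = \rank (gram u a).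
Proof.
move=> c0; rewrite -(mxrank_scale_nz (gram u a) c0); congr (\rank _).
apply/matrixP => i j; rewrite gram_entry mxE gram_entry mulr_sumr.
by apply: eq_bigr => e _; rewrite mxE !mulrA.
Qed.

(** The vectors of [w] and those of the basis chosen in [form_rank] are combinations of each other,
    and the rank of the Gram matrix is monotone in the row space. *)
Lemma form_rankE (W : {vspace 'rV[K]_n}) (w : (\dim W).-tuple 'rV[K]_n) a :
  basis_of W w ->
  form_rank (form_restr W (BE a)) = \rank (gram (rows_mx w) a).
Proof.
move=> wW; pose B := vbasis {:subvs_of W}.
pose V : 'M_(_, n) := \matrix_i vsval (tnth B i).
have -> : form_rank (form_restr W (BE a)) = \rank (gram V a).
  rewrite /form_rank; congr (\rank _); apply/matrixP => i j.
  by rewrite mxE gram_entry; apply: eq_bigr => e _; rewrite !mxE.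
have sum_rows k (M : 'M[K]_(k, n)) c (F : 'I_k -> 'rV_n) :
    (forall i, F i = row i M) -> ((\sum_i c i *: F i)%R <= M)%MS.
  by move=> FM; apply: summx_sub => i _; rewrite FM scalemx_sub ?row_sub.
apply/eqP; rewrite eqn_leq; apply/andP; split; apply: mxrank_gram_leq.
  apply/row_subP => i; rewrite rowK.
  rewrite (coord_basis wW (subvsP _)); apply: sum_rows => j.
  by rewrite rowK (tnth_nth 0).
apply/row_subP => i; rewrite rowK.
rewrite -(vsprojK (basis_mem wW (mem_tnth i w))).
rewrite (coord_vbasis (memvf (vsproj W (tnth w i)))) linear_sum.
rewrite (eq_bigr (fun j => coord B j (vsproj W (tnth w i)) *: vsval (tnth B j))).
  by apply: sum_rows => j; rewrite rowK.
by move=> j _; rewrite linearZ /= [tnth B j](tnth_nth 0).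
Qed.

End FormRank.

(** * Representatives of projective points *)

Section ProjectivePoints.

Variables (K : fieldType) (n : nat) (p : proj_space K n).

Lemma proj_point_rep : exists2 a, a \in val p & a != 0.
Proof.
exists (vpick (val p)); first exact: memv_pick.
by rewrite vpick0 -dimv_eq0 (eqP (valP p)).
Qed.

(** [proj_set] ranges over all representatives; this reduces a scaling-invariant condition to a
    single one. *)
Lemma proj_point_scale a b :
  a \in val p -> a != 0 -> b \in val p -> b != 0 -> exists2 c, c != 0 & b = c *: a.
Proof.
move=> pa a0 pb b0; have pE : val p = <[a]>%VS.
  apply/esym/eqP; rewrite eqEdim -memvE pa dim_vline a0.
  by rewrite (eqP (valP p)).
move: pb; rewrite pE => /vlineP[c bE]; exists c => //.
by apply: contraNneq b0 => c0; rewrite bE c0 scale0r.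
Qed.

End ProjectivePoints.

(** * Comparison of the singular, degeneracy and corank loci *)

Theorem theorem4p13 (K : fieldType) (charK : [pchar K] =i pred0) (n : nat)
    (W : {vspace 'rV[K]_n}) (W_neq0 : W != 0%VS)
    (w : (\dim W).-tuple 'rV[K]_n) (w_basis : basis_of W w) :
  (forall k : nat, (1 <= k <= \dim W - 1)%N ->
     forall p : proj_space K n,
       Sing_ge k (conf_ideal w) p <-> degeneracy_locus W (\dim W - k - 1) p) /\
  (forall k : nat, (1 <= k <= \dim W)%N ->
     forall p : proj_space K n,
       Mult k (conf_ideal w) p <-> Corank W k p).
Proof.
pose rk a := \rank (gram (rows_mx w) a).
(* [W] being nonzero yields the variable that [S_ideal_vanishing] asks for. *)
have n_gt0 : (0 < n)%N.
  have: (\dim W <= 1 * n)%N by have := dimvS (subvf W); rewrite dimvf.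
  by rewrite mul1n; apply: leq_trans; rewrite lt0n dimv_eq0.
have freew := row_free_rows_mx (basis_free w_basis).
have order_rk (a : 'rV_n) k :
    order_ge (fun i => a 0 i) k (gen_det (rows_mx w)) <-> (k <= \dim W - rk a)%N.
  split=> [ordk|lek]; last exact: order_ge_leq lek (order_ge_gen_det _ _).
  rewrite leqNgt; apply/negP => ltk.
  exact: (gen_det_order_le charK freew) (order_ge_leq ltk ordk).
(* The [k]-th iterate detects order [k + 1], hence the strict inequality. *)
have vanish_rk k (a : 'rV_n) :
    (forall f, iter k (@S_ideal K n) (conf_ideal w) f -> f.@[fun i => a 0 i] = 0) <->
    (k < \dim W - rk a)%N.
  apply: iff_trans (order_rk _ _).
  apply: iff_trans (S_ideal_vanishing _ _ (Ordinal n_gt0) _) _.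
    exact: gen_idealMl.
  split=> [kI|ordk f]; first by rewrite -conf_polyE; apply/kI/gen_ideal_gen.
  by apply: order_ge_gen_ideal => _ ->; rewrite conf_polyE.
have sing_rk k (p : proj_space K n) a : a \in val p -> a != 0 ->
    Sing_ge k (conf_ideal w) p <-> (k < \dim W - rk a)%N.
  move=> pa a0; split=> [/(_ a pa a0)/vanish_rk //|ltk b pb b0]; apply/vanish_rk.
  by have [c c0 ->] := proj_point_scale pa a0 pb b0; rewrite /rk mxrank_gramZ.
split=> k /andP[k_ge1 k_le] p; have [a pa a0] := proj_point_rep p.
  (* As [k < \dim W], truncated subtraction is exact, so [k < \dim W - rk a] means
     [rk a <= \dim W - k - 1]. *)
  rewrite (sing_rk k p a pa a0); split=> [ltk b pb b0|/(_ a pa a0)].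
    have [c c0 ->] := proj_point_scale pa a0 pb b0.
    by rewrite (form_rankE _ w_basis) mxrank_gramZ // -/(rk a); lia.
  by rewrite (form_rankE _ w_basis) -/(rk a); lia.
have dimW : \dim {:subvs_of W} = \dim W by rewrite dimvf.
(* Since [1 <= k], a corank above [k - 1] but not above [k] equals [k]. *)
rewrite /Mult !(sing_rk _ p a pa a0); split=> [[] ? /negP ? b pb b0|/(_ a pa a0)].
  have [c c0 ->] := proj_point_scale pa a0 pb b0.
  by rewrite /form_corank dimW (form_rankE _ w_basis) mxrank_gramZ // -/(rk a); lia.
rewrite /form_corank dimW (form_rankE _ w_basis) -/(rk a) => corank_a.
by split; [lia | apply/negP; lia].
Qed.
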